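(* Let $\mathcal F$ be a compact-dominating function system on a Tychonoff space $X$. Then the following conditions are equivalent: (1) $\mathcal F$ is locally contracting; (2) $\mathcal F$ is Edelstein contracting with respect to some admissible multimetric $\mathcal D$ on $X$; (3) $\mathcal F$ is Edelstein contracting with respect to some admissible bounded multimetric $\mathcal D$ on $X$ of cardinality $|\mathcal D|=\mathfrak{mn}(X)$. If $X$ is a $k$-space, then the conditions (1)--(3) are equivalent to each of: (4) $\mathcal F$ is topologically contracting; (5) $\mathcal F$ is compactly contracting. If the Tychonoff space $X$ is sequentially complete, then the conditions (1)--(3) are equivalent to: (6) $\mathcal F$ is Edelstein contracting with respect to some sequentially complete admissible bounded multimetric $\mathcal D$ on $X$.
   Context: All spaces are non-empty. $\omega=\{0,1,2,\dots\}$. A multimetric on a set $X$ is a family $\mathcal D$ of pseudometrics on $X$ such that for any distinct $x,y\in X$ there is $d\in\mathcal D$ with $d(x,y)>0$. Its canonical topology is the smallest topology on $X$ in which all $d\in\mathcal D$ are continuous. A multimetric $\mathcal D$ on a topological space $X$ is admissible if its canonical topology is the topology of $X$; it is bounded if $\sup_{x,y\in X}d(x,y)<\infty$ for each $d\in\mathcal D$. A sequence in $X$ is $\mathcal D$-Cauchy if it is $d$-Cauchy for every $d\in\mathcal D$; $\mathcal D$ is sequentially complete if every $\mathcal D$-Cauchy sequence converges in $X$. A Tychonoff space $X$ is sequentially complete if the multimetric $\mathcal D_X$ of all continuous pseudometrics on $X$ is sequentially complete. The metrizability number is $\mathfrak{mn}(X)=\min\{|\mathcal D|:\mathcal D\text{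 is an admissible multimetric on }X\}$. A topological space $X$ is a $k$-space if $U\subset X$ is open iff $K\cap U$ is open in $K$ for every compact $K\subset X$. A function system on $X$ is a non-empty finite family $\mathcal F$ of continuous maps $X\to X$. Put $\mathcal F^0=\{\mathrm{id}_X\}$, $\mathcal F^{n+1}=\{f\circ g: f\in\mathcal F,\ g\in\mathcal F^n\}$, $\mathcal F^{\ge k}=\bigcup_{n\ge k}\mathcal F^n$, and $\mathcal F(A)=\bigcup_{f\in\mathcal F}f(A)$ for $A\subset X$. $\mathcal F$ is compact-dominating if each compact $C\subset X$ is contained in a compact $K\subset X$ with $\mathcal F(K)\subset K$. $\mathcal F$ is topologically contracting if it is compact-dominating and for every non-empty compact $K\subset X$ with $\mathcal F(K)\subset K$ and every sequence $(f_n)_{n\in\omega}\in\mathcal F^\omega$ the intersection $\bigcap_{n\in\omega}f_0\circ\dots\circ f_n(K)$ is a singleton. For families of sets, $\mathcal U\prec\mathcal V$ means that each $U\in\mathcal U$ is contained in some $V\in\mathcal V$. $\mathcal F$ is compactly contracting if $\mathcal F(C)\subset C$ for some non-empty compact $C\subset X$ and for every compact $K\subset X$ and every open cover $\mathcal U$ of $X$ there is $n\in\omega$ with $\{f(K):f\in\mathcal F^{\ge n}\}\prec\mathcal U$. $\mathcal F$ is locally contracting if $\mathcal F(C)\subset C$ for some non-empty compact $C\subset X$ and for every compact $K\subset X$ and every open cover $\mathcal U$ of $X$ there are a neighborhood $O_K$ of $K$ in $X$ and $n\in\omega$ with $\{f(O_K):f\in\mathcal F^{\ge n}\}\prec\mathcal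 U$. $\mathcal F$ is Edelstein contracting with respect to $\mathcal D$ if for every $d\in\mathcal D$, $f\in\mathcal F$ and points $x,y\in X$ there is a constant $\lambda<1$ such that $d(f(x),f(y))\le\lambda\cdot d(x,y)$. *)

(* Defs.v *)
From HB Require Import structures.
From mathcomp Require Import all_boot all_order all_algebra.
From mathcomp Require Import all_classical all_reals all_analysis.

Set Implicit Arguments.
Unset Strict Implicit.
Unset Printing Implicit Defensive.

Import Order.TTheory GRing.Theory Num.Theory.
Import numFieldNormedType.Exports.

Local Open Scope classical_set_scope.
Local Open Scope ring_scope.
Local Open Scope card_scope.

Definition tychonoff_space (X : topologicalType) : Prop :=
  hausdorff_space X /\ completely_regular_space X.

Definition k_space (X : topologicalType) : Prop :=
  forall U : set X,
    open U <-> forall K : set X, compact K -> open (K `&` U : set (subspace K)).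

Section Multimetrics.
Context {R : realType} {X : topologicalType}.

Definition pseudometric (d : X -> X -> R) : Prop :=
  [/\ forall x y, 0 <= d x y,
      forall x, d x x = 0,
      forall x y, d x y = d y x
    & forall x y z, d x z <= d x y + d y z].

(* Multimetrics are sets of distance functions, so that [|D|] is [D] up to
   [#=]; the empty set is allowed (it is a multimetric on a singleton). *)
Definition multimetric (D : set (X -> X -> R)) : Prop :=
  (forall d, D d -> pseudometric d) /\
  (forall x y, x <> y -> exists2 d, D d & 0 < d x y).

(* [t] is an arbitrary topology on the carrier of [X], in general different
   from the topology of [X]; continuity is on the product of [t] with itself. *)
Definition continuous_for (t : Topological X) (d : X -> X -> R) : Prop :=
  let Xt : topologicalType := Topological.Pack t in
  continuous (fun p : (Xt * Xt)%type => d p.1 p.2).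

Definition is_canonical_topology (D : set (X -> X -> R)) (t : Topological X) :
    Prop :=
  (forall d, D d -> continuous_for t d) /\
  (forall t' : Topological X, (forall d, D d -> continuous_for t' d) ->
     @open (Topological.Pack t) `<=` @open (Topological.Pack t')).

Definition admissible (D : set (X -> X -> R)) : Prop :=
  multimetric D /\ is_canonical_topology D (Topological.class X).

Definition bounded_multimetric (D : set (X -> X -> R)) : Prop :=
  forall d, D d -> exists M : R, forall x y, d x y <= M.

Definition cauchy_seq_for (d : X -> X -> R) (u : nat -> X) : Prop :=
  forall e : R, 0 < e ->
    exists N : nat, forall m n, (N <= m)%N -> (N <= n)%N -> d (u m) (u n) < e.

Definition seq_complete (D : set (X -> X -> R)) : Prop :=
  forall u : nat -> X, (forall d, D d -> cauchy_seq_for d u) ->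
    exists l : X, u @ \oo --> l.

End Multimetrics.

(* [|C|] is the least cardinality of an admissible multimetric on [X]. *)
Definition card_eq_mn (R : realType) (X : topologicalType) {T : Type}
    (C : set T) : Prop :=
  (exists2 D0 : set (X -> X -> R), admissible D0 & C #= D0) /\
  (forall D : set (X -> X -> R), admissible D -> C #<= D).

Definition continuous_pseudometrics (R : realType) (X : topologicalType) :
    set (X -> X -> R) :=
  [set d | pseudometric d /\ continuous_for (Topological.class X) d].
Arguments continuous_pseudometrics : clear implicits.

Definition seq_complete_space (R : realType) (X : topologicalType) : Prop :=
  seq_complete (continuous_pseudometrics R X).

Section FunctionSystems.
Context {X : topologicalType}.
Implicit Types (F : set (X -> X)) (A : set X) (UU VV : set (set X)).

Definition function_system F : Prop :=
  [/\ F !=set0, finite_set F & forall f, F f -> continuous f].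

Definition fs_image F A : set X := \bigcup_(f in F) (f @` A).

Fixpoint fs_iter F (n : nat) : set (X -> X) :=
  if n is m.+1 then [set f \o g | f in F & g in fs_iter F m] else [set idfun].

Definition fs_iter_ge F (k : nat) : set (X -> X) :=
  \bigcup_(n in [set n | (k <= n)%N]) fs_iter F n.

(* [f 0 \o f 1 \o ... \o f n] *)
Fixpoint comp_upto (f : nat -> X -> X) (n : nat) : X -> X :=
  if n is m.+1 then comp_upto f m \o f n else f 0%N.

Definition compact_dominating F : Prop :=
  forall C : set X, compact C ->
    exists K : set X, [/\ compact K, C `<=` K & fs_image F K `<=` K].

Definition topologically_contracting F : Prop :=
  compact_dominating F /\
  forall K : set X, K !=set0 -> compact K -> fs_image F K `<=` K ->
  forall f : nat -> X -> X, (forall n, F (f n)) ->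
  exists x : X, \bigcap_n (comp_upto f n @` K) = [set x].

Definition refines UU VV : Prop :=
  forall U, UU U -> exists2 V, VV V & U `<=` V.

Definition open_cover UU : Prop :=
  (forall U, UU U -> open U) /\ \bigcup_(U in UU) U = [set: X].

Definition has_invariant_compact F : Prop :=
  exists C : set X, [/\ C !=set0, compact C & fs_image F C `<=` C].

Definition compactly_contracting F : Prop :=
  has_invariant_compact F /\
  forall (K : set X) UU, compact K -> open_cover UU ->
  exists n : nat, refines [set f @` K | f in fs_iter_ge F n] UU.

Definition locally_contracting F : Prop :=
  has_invariant_compact F /\
  forall (K : set X) UU, compact K -> open_cover UU ->
  exists2 O : set X, set_nbhs K O &
    exists n : nat, refines [set f @` O | f in fs_iter_ge F n] UU.

Definition edelstein_contracting {R : realType} F (D : set (X -> X -> R)) :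
    Prop :=
  forall d f, D d -> F f -> forall x y : X,
    exists2 lambda : R, lambda < 1 & d (f x) (f y) <= lambda * d x y.

End FunctionSystems.

(* Main.v *)
Require Import Defs.
From HB Require Import structures.
From mathcomp Require Import all_boot all_order all_algebra.
From mathcomp Require Import all_classical all_reals all_analysis.
From mathcomp Require Import lra.

Local Open Scope classical_set_scope.

(** Two constructions carry the proof.

From contraction to a metric: local contraction implies Edelstein contraction.
Given a continuous pseudometric [d], first truncated at 1, consider
  [d^ x y = sup_n sup_(f in F^n) w_n * d (f x) (f y)]
with weights [w_n = 2 - 2^-n] increasing from 1 to 2. Composing with [g] in [F]
shifts the supremum by one index, so each term of [d^ (g x) (g y)] is a term of
[d^ x y] multiplied by [w_n / w_(n+1) < 1]. These ratios tend to 1, but the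
iterates of [F] contract the compact set [{x, y}], so that the terms of large
index are negligible and only finitely many ratios matter
([orbit_sup_edelstein]). Since [d^] dominates the truncation of [d], a family
of such [d^] inherits separation and sequential completeness from the family of
the [d], and it remains admissible as soon as the [d^] are continuous. Continuity of [d^] is again the statement that the terms
of large index are negligible, now uniformly near a point. Local contraction
gives this for neighborhoods, and compact contraction gives it for points
staying in a compact set, which suffices in a [k]-space ([orbit_sup_near] treats
both). The family has at most as many members as the one it comes from, and an
admissible multimetric of least cardinality exists ([minimal_cardinal]), so
the hulls of its members form a multimetric of that cardinality.

From a metric to contraction: Edelstein contraction implies local contraction.
For one pseudometric [d] and an invariant compact set [K], compactness turns the
pointwise strict inequality [d (f x) (f y) < d x y] into a uniform loss [eta] on
the pairs of [K] at distance at least [e] ([edelstein_gap]); as distances on [K]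
are bounded, after finitely many steps every pair of [K] is at distance less
than [e] ([edelstein_shrinks]). A Lebesgue number for the open cover
([lebesgue_number]) involves finitely many pseudometrics, whose sum is again
Edelstein contracting, and non-expansiveness extends the estimate from [K] to a
uniform neighborhood of [K] ([edelstein_locally_contracting]).

Finally, compact contraction implies topological contraction because two points
in the intersection of the sets [f_0 \o ... \o f_n (K)] are separated by the
cover by their complements; the converse is an application of Koenig's lemma to
the tree of compositions whose images of [K] lie in no member of the cover. *)

Section EdelsteinMetrization.
Set Implicit Arguments.
Unset Strict Implicit.
Import Order.TTheory GRing.Theory Num.Theory.
Import numFieldNormedType.Exports.
Local Open Scope ring_scope.

(** * Continuous pseudometrics *)

Section Pseudometrics.
Context {R : realType}.

(** By the triangle inequality [d x' y'] differs from [d x y] by at most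
[d x x' + d y y'], so joint continuity reduces to the balls being neighborhoods
of their centers. *)
Lemma continuous_pseudometricP (Y : topologicalType) (d : Y -> Y -> R) :
  pseudometric d ->
  continuous (fun p : (Y * Y)%type => d p.1 p.2) <->
  forall x e, 0 < e -> \forall y \near x, d x y < e.
Proof.
move=> [d0 dxx dC dT]; split.
  move=> dc x e e0; have := dc (x, x) => /cvgrPdist_lt /(_ _ e0) /=.
  rewrite dxx => -[[A B] /= [Ax Bx] AB].
  near=> y; have := AB (x, y); rewrite /= sub0r normrN ger0_norm//; apply.
  split => /=; last by near: y.
  exact: nbhs_singleton Ax.
move=> dn [x y]; apply/cvgrPdist_lt => e e0 /=.
have e20 : 0 < e / 2 by lra.
exists ([set x' | d x x' < e / 2], [set y' | d y y' < e / 2]) => /=.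
  by split; exact: dn.
move=> [x' y'] /= [xx' yy'].
have h1 := dT x x' y; have h2 := dT x' y' y.
have h3 := dT x' x y'; have h4 := dT x y y'.
rewrite (dC y' y) (dC x' x) in h2 h3.
by rewrite ltr_norml; apply/andP; split; lra.
Unshelve. all: by end_near. Qed.

(** [Topological.Pack (Topological.class X)] is [X] only up to the eta rule for
structures; this lemma and the next one bridge the gap. *)
Lemma continuous_for_class (X : topologicalType) (d : X -> X -> R) :
  continuous_for (Topological.class X) d <->
  continuous (fun p : (X * X)%type => d p.1 p.2).
Proof. by case: X d. Qed.

Lemma open_class (X : topologicalType) :
  @open (Topological.Pack (Topological.class X)) = @open X.
Proof. by case: X. Qed.

Lemma continuous_pseudometrics_near (X : topologicalType) (d : X -> X -> R) :
  continuous_pseudometrics R X d <->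
  pseudometric d /\ forall x e, 0 < e -> \forall y \near x, d x y < e.
Proof.
split=> -[dp dc]; split => //.
  by apply/continuous_pseudometricP/continuous_for_class.
by apply/continuous_for_class/continuous_pseudometricP.
Qed.

End Pseudometrics.

(** * The canonical topology of a multimetric *)

Section Canonical.
Context {R : realType} {X : topologicalType}.
Implicit Types (d : X -> X -> R) (D : set (X -> X -> R)).

(** Finite sums replace finite maxima: they define the same topology, and
Edelstein contraction passes to a sum term by term. *)
Definition pm_sum (s : seq (X -> X -> R)) : X -> X -> R :=
  foldr (fun d d' x y => d x y + d' x y) (fun _ _ => 0) s.

Lemma pseudometric0 : pseudometric (fun _ _ : X => 0 : R).
Proof. by split=> // *; rewrite addr0. Qed.

Lemma pseudometricD d d' : pseudometric d -> pseudometric d' ->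
  pseudometric (fun x y => d x y + d' x y).
Proof.
move=> [d0 dxx dC dT] [d0' dxx' dC' dT']; split => [x y|x|x y|x y z].
- exact: addr_ge0.
- by rewrite dxx dxx' addr0.
- by rewrite dC dC'.
- by have := dT x y z; have := dT' x y z; lra.
Qed.

Definition family_in D (s : seq (X -> X -> R)) := forall d, List.In d s -> D d.

Lemma pm_sum_ind D (P : (X -> X -> R) -> Prop) : P (fun _ _ => 0) ->
  (forall d d', D d -> P d -> P d' -> P (fun x y => d x y + d' x y)) ->
  (forall d, D d -> P d) ->
  forall s, family_in D s -> P (pm_sum s).
Proof.
move=> P0 PD Pd; elim => //= d s IH ds.
have Dd : D d by apply: ds; left.
by apply: PD => //; [exact: Pd|apply: IH => d' ?; apply: ds; right].
Qed.

Lemma pm_sum_cat s s' x y :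
  pm_sum (s ++ s') x y = pm_sum s x y + pm_sum s' x y.
Proof. by elim: s => /= [|d s ->]; rewrite ?add0r ?addrA. Qed.

Lemma family_in_cat D s s' : family_in D s -> family_in D s' ->
  family_in D (s ++ s').
Proof.
elim: s => //= d s IH ds ds' d' [<-|]; first by apply: ds; left.
by apply: IH => // e es; apply: ds; right.
Qed.

Definition gauge_open D (U : set X) := forall x, U x ->
  exists s e, [/\ family_in D s, 0 < e & forall y, pm_sum s x y < e -> U y].

Variable D : set (X -> X -> R).
Hypothesis D_pseudometric : forall d, D d -> pseudometric d.

Lemma pm_sum_pseudometric s : family_in D s -> pseudometric (pm_sum s).
Proof.
apply: (@pm_sum_ind D (@pseudometric R X)) => [|d d' _|].
- exact: pseudometric0.
- exact: pseudometricD.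
- exact: D_pseudometric.
Qed.

(** The alias carries the topology with open sets [gauge_open D], on the same
points as [X]; the proof argument keeps it available to instance inference. *)
Definition gauge_space of (forall d, D d -> pseudometric d) : Type := X.
Local Notation GX := (gauge_space D_pseudometric).

HB.instance Definition _ := Choice.on GX.

Let gauge_openT : gauge_open D (@setT GX).
Proof. by move=> x _; exists [::], 1; split. Qed.

Let gauge_openI : setI_closed (gauge_open D : set (set GX)).
Proof.
move=> U V oU oV x [/oU[s [e [Ds e0 sU]]] /oV[s' [e' [Ds' e0' sV]]]].
exists (s ++ s'), (Num.min e e'); split.
- exact: family_in_cat.
- by rewrite lt_min e0.
- move=> y; rewrite pm_sum_cat lt_min => /andP[he he'].
  have [h _ _ _] := pm_sum_pseudometric Ds.
  have [h' _ _ _] := pm_sum_pseudometric Ds'.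
  by split; [apply: sU|apply: sV]; have := h x y; have := h' x y; lra.
Qed.

Let gauge_open_bigU (I : Type) (f : I -> set GX) :
  (forall i, gauge_open D (f i)) -> gauge_open D (\bigcup_i f i).
Proof.
move=> fo x [i _ /(fo i)[s [e [Ds e0 sU]]]].
by exists s, e; split => // y /sU ?; exists i.
Qed.

HB.instance Definition _ :=
  isOpenTopological.Build GX gauge_openT gauge_openI gauge_open_bigU.

Lemma gauge_spaceE : @open GX = gauge_open D.
Proof. by []. Qed.

(** This makes [gauge_space] a competitor in the minimality clause of the
canonical topology. *)
Lemma gauge_space_continuous d : D d ->
  continuous_for (Topological.class GX) d.
Proof.
move=> Dd; have [d0 dxx dC dT] := D_pseudometric Dd.
apply/(@continuous_for_class R GX)/(@continuous_pseudometricP R GX).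
  exact: (D_pseudometric Dd).
move=> x e e0; apply: (@open_nbhs_nbhs GX); split; last by rewrite /= dxx.
rewrite gauge_spaceE => y /= xy.
exists [:: d], (e - d x y); split; first by move=> ? [<-|].
  by rewrite subr_gt0.
by move=> z /=; rewrite addr0 => yz; have := dT x y z; lra.
Qed.

End Canonical.

Section Admissible.
Context {R : realType} {X : topologicalType}.
Implicit Types (d : X -> X -> R) (D : set (X -> X -> R)).

(** The canonical topology is the smallest one making [D] continuous, hence it
is contained in the topology of [gauge_space]. *)
Lemma admissible_ball D (U : set X) x : admissible D -> open U -> U x ->
  exists s e, [/\ family_in D s, 0 < e & forall y, pm_sum s x y < e -> U y].
Proof.
move=> [[Dp _] [_ Dmin]] oU Ux.
have := Dmin _ (fun d => @gauge_space_continuous R X D Dp d).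
rewrite !open_class => /(_ _ oU); exact.
Qed.

Lemma admissible_near D d x e : admissible D -> D d -> 0 < e ->
  \forall y \near x, d x y < e.
Proof.
move=> [[Dp _] [Dc _]] Dd e0.
have [|_] := (continuous_pseudometrics_near d).1; last exact.
by split; [exact: Dp|exact: Dc].
Qed.

Lemma admissible_pm_sum_near D s x e : admissible D -> family_in D s ->
  0 < e -> \forall y \near x, pm_sum s x y < e.
Proof.
move=> aD Ds e0; pose P (d : X -> X -> R) :=
  forall e, 0 < e -> \forall y \near x, d x y < e.
suff : P (pm_sum s) by exact.
apply: pm_sum_ind Ds.
- by move=> a a0; near=> y.
- move=> d d' _ Pd Pd' a a0; have a20 : 0 < a / 2 by lra.
  have h : \forall y \near x, d x y < a / 2 by exact: Pd.
  have h' : \forall y \near x, d' x y < a / 2 by exact: Pd'.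
  near=> y; suff : d x y < a / 2 /\ d' x y < a / 2 by move=> [? ?]; lra.
  by split; near: y.
- by move=> d Dd a a0; exact: admissible_near aD Dd a0.
Unshelve. all: by end_near. Qed.

Definition truncate d : X -> X -> R := fun x y => Num.min (d x y) 1.

Lemma truncate_le1 d x y : truncate d x y <= 1.
Proof. by rewrite ge_min lexx orbT. Qed.

Lemma truncate_pseudometric d : pseudometric d -> pseudometric (truncate d).
Proof.
move=> [d0 dxx dC dT]; split => [x y|x|x y|x y z]; rewrite /truncate.
- by rewrite le_min d0 ler01.
- by rewrite dxx; apply/min_idPl; exact: ler01.
- by rewrite dC.
- have := dT x y z; have := d0 x y; have := d0 y z.
  by rewrite /Num.min; case: ifP; case: ifP; case: ifP; lra.
Qed.

Lemma truncate_continuous d : continuous_pseudometrics R X d ->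
  continuous_pseudometrics R X (truncate d).
Proof.
move=> /continuous_pseudometrics_near[dp dn].
apply/continuous_pseudometrics_near; split.
  exact: truncate_pseudometric.
move=> x e e0; near=> y; rewrite gt_min; apply/orP; left.
by near: y; exact: dn.
Unshelve. all: by end_near. Qed.

(** Small balls of [d'] lie in balls of [d], so a topology in which [D'] is
continuous makes [D] continuous too, and minimality carries over. Comparing
with the truncation is enough because only small radii matter. *)
Lemma admissible_dominating D D' : admissible D ->
  D' `<=` continuous_pseudometrics R X ->
  (forall d, D d -> exists2 d', D' d' & forall x y, truncate d x y <= d' x y) ->
  admissible D'.
Proof.
move=> [[Dp Dsep] [Dc Dmin]] D'c DD'; split; split.
- by move=> d /D'c[].
- move=> x y /Dsep[d Dd dxy]; have [d' D'd' le] := DD' _ Dd.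
  by exists d' => //; apply: lt_le_trans (le x y); rewrite lt_min dxy ltr01.
- by move=> d /D'c[].
move=> t' ht'; apply: Dmin => d Dd.
apply/continuous_pseudometricP; first exact: Dp.
move=> x e e0; have [d' D'd' le] := DD' _ Dd.
have d'p : pseudometric d' by have [] := D'c _ D'd'.
have m0 : 0 < Num.min e 1 by rewrite lt_min e0 ltr01.
have := ht' _ D'd' => /continuous_pseudometricP -/(_ d'p x _ m0).
apply: filterS => y; move: (le x y); rewrite /truncate lt_min.
move=> h1 /andP[h2 h3].
have := le_lt_trans h1 h3; rewrite gt_min ltxx orbF => h4.
by move: h1; rewrite (min_idPl (ltW h4)); lra.
Qed.

(** A function [f] separating [x] from the complement of a neighborhood yields
the pseudometric [`|f x - f y|], whose unit ball lies in that neighborhood. *)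
Lemma continuous_pseudometrics_admissible : tychonoff_space X ->
  admissible (continuous_pseudometrics R X).
Proof.
move=> [hX crX].
have sep (x : X) (U : set X) : open U -> U x ->
    exists2 d : X -> X -> R, continuous_pseudometrics R X d &
      forall y, d x y < 1 -> U y.
  move=> oU Ux.
  have : uniform_separator [set x] (~` U).
    by apply: crX; [exact: open_closedC|apply].
  move=> /(@uniform_separatorP _ R)[f [fc _ f0 f1]].
  exists (fun x y => `|f x - f y|).
    apply/continuous_pseudometrics_near; split.
      split=> [a b|a|a b|a b c].
      - exact: normr_ge0.
      - by rewrite subrr normr0.
      - exact: distrC.
      - by rewrite -(subrKA (f b)) ler_normD.
    move=> a e e0.
    by have /cvgrPdist_lt /(_ _ e0) := fc a.
  move=> y; apply: contraPP => nUy.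
  have -> : f x = 0 by apply: f0; exists x.
  have -> : f y = 1 by apply: f1; exists y.
  by rewrite sub0r normrN normr1 ltxx.
split; split.
- by move=> d [].
- move=> x y xy.
  have oU : open (~` [set y]).
    exact/closed_openC/accessible_closed_set1/hausdorff_accessible.
  have [d dc dU] := sep _ _ oU xy.
  exists d => //; apply: (@lt_le_trans _ _ 1) => //.
  by rewrite leNgt; apply/negP => /dU; apply.
- by move=> d [].
move=> t' ht'; rewrite open_class => U oU.
rewrite openE => x Ux; have [d dc dU] := sep _ _ oU Ux.
have := ht' _ dc => /continuous_pseudometricP -/(_ dc.1 x _ ltr01).
exact: filterS.
Qed.

End Admissible.

(** * Iterates of a function system *)

Section Iterates.
Context {X : topologicalType}.
Implicit Types (F : set (X -> X)) (K : set X) (UU : set (set X)).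

Lemma near_finite (I : Type) (J : choiceType) (A : set J)
    (G : set_system I) (P : J -> I -> Prop) : Filter G -> finite_set A ->
  (forall j, A j -> \forall i \near G, P j i) ->
  \forall i \near G, forall j, A j -> P j i.
Proof.
move=> FG /finite_fsetP[B ->] BP.
by apply: (@filter_bigI _ _ B P G FG).
Qed.

Lemma fs_iter_comp F m n g h : fs_iter F m g -> fs_iter F n h ->
  fs_iter F (m + n) (g \o h).
Proof.
move=> + Fh; elim: m g => [g ->//|m IH _ [f Ff [g Fg <-]]] /=.
by exists f => //; exists (g \o h) => //; exact: IH.
Qed.

Lemma fs_iter_split F m n h : fs_iter F (m + n) h ->
  exists2 h1, fs_iter F m h1 & exists2 h2, fs_iter F n h2 & h = h1 \o h2.
Proof.
elim: m h => [h Fh|m IH _ [f Ff [g /IH[g1 Fg1 [g2 Fg2 ->]] <-]]].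
  by exists idfun => //; exists h.
by exists (f \o g1); [exists f => //; exists g1|exists g2].
Qed.

Lemma fs_iter1 F f : F f -> fs_iter F 1 f.
Proof. by move=> Ff; exists f => //; exists idfun. Qed.

Lemma fs_iter_continuous F n f : function_system F -> fs_iter F n f ->
  continuous f.
Proof.
move=> [_ _ Fc]; elim: n f => [_ -> x//|n IH _ [f Ff [g Fg <-]] x].
by apply: continuous_comp; [exact: IH|exact: Fc].
Qed.

Lemma fs_iter_finite F n : finite_set F -> finite_set (fs_iter F n).
Proof.
move=> finF; elim: n => [|n IH] /=; first exact: finite_set1.
exact: (finite_image2 (fun f g : X -> X => f \o g)).
Qed.

Lemma fs_iter_invariant F n f K : fs_image F K `<=` K -> fs_iter F n f ->
  f @` K `<=` K.
Proof.
move=> FK; elim: n f => [_ -> _ [x Kx <-]//|n IH _ [f Ff [g Fg <-]]].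
move=> _ [x Kx <-]; apply: FK; exists f => //; exists (g x) => //.
by apply: IH Fg _ _; exists x.
Qed.

Lemma comp_upto_iter F f n : (forall k, F (f k)) ->
  fs_iter F n.+1 (comp_upto f n).
Proof.
move=> Ff; elim: n => [|n IH]; first exact/fs_iter1/Ff.
by rewrite -addn1; apply: (fs_iter_comp IH); exact: fs_iter1.
Qed.

Lemma comp_upto_decreasing F f K m n : (forall k, F (f k)) ->
  fs_image F K `<=` K -> (m <= n)%N ->
  comp_upto f n @` K `<=` comp_upto f m @` K.
Proof.
move=> Ff FK /subnKC <-; elim: (n - m)%N => [|k IH]; first by rewrite addn0.
apply: subset_trans IH; rewrite addnS => _ [x Kx <-] /=.
exists (f (m + k).+1 x) => //; apply: FK.
by exists (f (m + k).+1) => //; exists x.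
Qed.

Lemma has_invariant_compact_dominating F : [set: X] !=set0 ->
  compact_dominating F -> has_invariant_compact F.
Proof.
move=> [x _] /(_ _ (@compact_set1 _ x))[K [cK xK FK]].
by exists K; split => //; exists x; exact: xK.
Qed.

Lemma locally_compactly_contracting F : locally_contracting F ->
  compactly_contracting F.
Proof.
move=> [hF lF]; split => // K UU cK oU.
have [W KW [n nW]] := lF K UU cK oU; exists n => _ [f Ff <-].
have [V UV WV] := nW _ (imageP (fun f => f @` W) Ff).
exists V => // _ [x Kx <-]; apply: WV; exists x => //.
exact: nbhs_singleton (KW x Kx).
Qed.

(** If [x <> y] both lie in the intersection, no long composition can map [K]
into the complement of [x] or into the complement of [y], although these two
sets cover the space. *)
Lemma compactly_topologically_contracting F : hausdorff_space X ->
  function_system F -> compact_dominating F ->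
  compactly_contracting F -> topologically_contracting F.
Proof.
move=> hX sF dF [_ cF]; split => // K K0 cK FK f Ff.
pose A n := comp_upto f n @` K.
have Adecr m n : (m <= n)%N -> A n `<=` A m.
  exact: comp_upto_decreasing Ff FK.
have cA n : closed (A n).
  apply: compact_closed => //; apply: continuous_compact => //.
  apply: continuous_subspaceT.
  exact: fs_iter_continuous sF (comp_upto_iter n Ff).
have [x Ax] : (\bigcap_n A n) !=set0.
  pose G := filter_from [set: nat] A.
  have PG : ProperFilter G.
    apply: filter_from_proper; last by move=> n _; exact: image_nonempty.
    apply: filter_from_filter; first by exists 0%N.
    move=> m n _ _; exists (maxn m n) => // y Ay.
    by split; apply: Adecr Ay; [exact: leq_maxl|exact: leq_maxr].
  have GK : G K.
    exists 0%N => //.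
    exact: fs_iter_invariant FK (comp_upto_iter 0 Ff).
  have [x [Kx clx]] := cK _ PG GK; exists x => n _.
  apply: cA => B Bx; apply: clx Bx; by exists n.
exists x; apply/seteqP; split => [y Ay|_ ->//]; apply: contrapT => yx.
pose UU := [set ~` [set x]; ~` [set y]].
have oUU : open_cover UU.
  split; first by move=> _ [->|->];
    exact/closed_openC/accessible_closed_set1/hausdorff_accessible.
  apply/seteqP; split => // z _; have [->|zx] := pselect (z = x).
    by exists (~` [set y]); [right|move=> xy; exact: yx].
  by exists (~` [set x]); [left|].
have [n nUU] := cF _ _ cK oUU.
have Fn : fs_iter_ge F n (comp_upto f n).
  by exists n.+1; [exact: leqnSn|exact: comp_upto_iter].
have [V + AV] := nUU _ (imageP (fun f => f @` K) Fn).
by move=> [|] VE; [have := AV _ (Ax n I)|have := AV _ (Ay n I)];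
  rewrite VE; apply.
Qed.

(** Koenig's lemma. Call [g] bad if for every [n] some [g \o h], with [h] in
[F^n], maps [K] into no member of the cover. If the cover defeats compact
contraction, the identity is bad, and finiteness of [F] lets a bad [g] be
extended to a bad [g \o f]. The resulting infinite branch contradicts
topological contraction: its intersection is a point, which lies in some member
[V] of the cover, and by compactness [V] contains the image of [K] under a
finite part of the branch. *)
Lemma topologically_compactly_contracting F : [set: X] !=set0 ->
  hausdorff_space X -> function_system F ->
  topologically_contracting F -> compactly_contracting F.
Proof.
move=> X0 hX sF [dF tF].
split; first exact: has_invariant_compact_dominating.
move=> K0 UU cK0 [oUU cUU].
have [x0 _] := X0.
have cK0x : compact (K0 `|` [set x0]).
  by apply: compactU => //; exact: compact_set1.
have [K [cK K0K FK]] := dF _ cK0x.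
have K_nonempty : K !=set0 by exists x0; apply: K0K; right.
pose fits g := exists2 V, UU V & g @` K `<=` V.
pose bad g := forall n, exists2 h, fs_iter F n h & ~ fits (g \o h).
have fitsS g n h : fits g -> fs_iter F n h -> fits (g \o h).
  move=> [V UV gV] Fh; exists V => //; rewrite -image_comp.
  by apply: subset_trans gV; apply: image_subset; exact: fs_iter_invariant Fh.
have bad_step g : bad g -> exists2 f, F f & bad (g \o f).
  move=> bg; apply: contrapT => nf.
  have evF : \forall n \near \oo, forall f, F f ->
     forall h, fs_iter F n h -> fits (g \o f \o h).
    apply: near_finite; first by case: sF.
    move=> f Ff; apply: contrapT => nev; apply: nf; exists f => // n.
    apply: contrapT => allfit; apply: nev; exists n => // m /= nm h.
    rewrite -(subnKC nm) => /fs_iter_split[h1 Fh1 [h2 Fh2 ->]].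
    rewrite (_ : _ \o _ = (g \o f \o h1) \o h2)//; apply: fitsS Fh2.
    by apply: contrapT => nfit; apply: allfit; exists h1.
  have [n _ /(_ n (leqnn n)) nF] := evF.
  have [_ [f Ff [h Fh <-]] nfit] := bg n.+1.
  exact: nfit (nF f Ff h Fh).
have [|nfin] := pselect (bad idfun); last first.
  have /existsNP[n nn] := nfin; exists n => _ [f [m nm Ff] <-].
  have fitf : fits f.
    apply: contrapT => nff; apply: nn.
    move: Ff; rewrite -(subnKC nm) => /fs_iter_split[h1 Fh1 [h2 Fh2 E]].
    exists h1 => // fh1; apply: nff; rewrite E; exact: fitsS fh1 Fh2.
  have [V UV fV] := fitf; exists V => //; apply: subset_trans fV.
  by apply: image_subset => z zK; apply: K0K; left.
move=> bad_id; exfalso.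
have [nxt nxtP] : {nxt & forall g, bad g -> F (nxt g) /\ bad (g \o nxt g)}.
  apply: (@choice _ _ (fun g f => bad g -> F f /\ bad (g \o f))) => g.
  have [/bad_step[f Ff bf]|ng] := pselect (bad g); first by exists f.
  by exists idfun.
pose st := fix st n := if n is m.+1 then st m \o nxt (st m) else idfun.
have bad_st n : bad (st n).
  by elim: n => // n /nxtP[].
pose f n := nxt (st n).
have Ff n : F (f n) by have [] := nxtP _ (bad_st n).
have stE n : comp_upto f n = st n.+1 by elim: n => // n /= ->.
have [x Ax] := tF _ K_nonempty cK FK f Ff.
have Adecr m n : (m <= n)%N -> comp_upto f n @` K `<=` comp_upto f m @` K.
  exact: comp_upto_decreasing Ff FK.
have [V UV Vx] : exists2 V, UU V & V x.
  by have : [set: X] x by []; rewrite -cUU => -[V UV Vx]; exists V.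
have : \forall n \near \oo, K `<=` (fun y => (comp_upto f n @` K) y -> V y).
  apply: (((@compact_near_coveringP X K).1 cK) nat \oo
    (fun n y => (comp_upto f n @` K) y -> V y)) => y Ky.
  have [Vy|nVy] := pselect (V y).
    near=> y' n => /= _; near: y'.
    by apply: open_nbhs_nbhs; split => //; exact: oUU.
  have [n nAy] : exists n, ~ (comp_upto f n @` K) y.
    apply: contrapT => allA; apply: nVy; suff -> : y = x by [].
    suff : (\bigcap_n (comp_upto f n @` K)) y by rewrite Ax.
    by move=> n _; apply: contrapT => nA; apply: allA; exists n.
  have nbhs_nA : nbhs y (~` (comp_upto f n @` K)).
    apply: open_nbhs_nbhs; split => //; apply: closed_openC.
    apply: compact_closed => //; apply: continuous_compact => //.
    apply: continuous_subspaceT.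
    exact: fs_iter_continuous sF (comp_upto_iter n Ff).
  exists (~` (comp_upto f n @` K), [set m | (n <= m)%N]) => /=.
    by split=> //; exists n.
  by move=> [y' m] /= [nA nm] /(Adecr _ _ nm).
move=> [n _ /(_ n (leqnn n)) AV].
have FK' := fs_iter_invariant FK (comp_upto_iter n Ff).
have [h -> {h}] := bad_st n.+1 0%N; apply; exists V => //.
by rewrite -stE => y Ay; apply: AV => //; exact: FK'.
Unshelve. all: by end_near. Qed.

End Iterates.

(** * Contracting pseudometrics from contracting systems *)

Section OrbitSup.
Context {R : realType} {X : topologicalType}.
Implicit Types (F : set (X -> X)) (d : X -> X -> R) (K : set X).

Lemma pseudometric_ball_open d x e : continuous_pseudometrics R X d ->
  open [set y | d x y < e].
Proof.
move=> /continuous_pseudometrics_near[[d0 dxx dC dT] dn].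
rewrite openE => y /= xy.
have : 0 < e - d x y by rewrite subr_gt0.
move=> /(dn y); apply: filterS => z yz /=.
by have := dT x y z; lra.
Qed.

Definition ball_cover d e : set (set X) :=
  [set [set y | d x y < e] | x in setT].

Lemma ball_cover_open d e : continuous_pseudometrics R X d -> 0 < e ->
  open_cover (ball_cover d e).
Proof.
move=> dc e0; split; first by move=> _ [x _ <-]; exact: pseudometric_ball_open.
apply/seteqP; split => // x _; exists [set y | d x y < e]; first by exists x.
by have [[_ dxx _ _] _] := dc; rewrite /= dxx.
Qed.

Lemma refines_ball_cover (I : Type) (A : set I) (G : I -> set X) d e :
  pseudometric d -> refines [set G i | i in A] (ball_cover d (e / 2)) ->
  forall i, A i -> forall y z, G i y -> G i z -> d y z < e.
Proof.
move=> [d0 dxx dC dT] h i Ai y z Gy Gz.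
have [_ [x _ <-] Gx] := h _ (imageP G Ai).
have /= := Gx _ Gy; have /= := Gx _ Gz; have := dT y x z.
by rewrite (dC y x); lra.
Qed.

Lemma compactly_contracting_shrinks F d K e : compactly_contracting F ->
  continuous_pseudometrics R X d -> compact K -> 0 < e ->
  exists N : nat, forall f, fs_iter_ge F N f ->
    forall x y, K x -> K y -> d (f x) (f y) < e.
Proof.
move=> [_ cF] dc cK e0; have e20 : 0 < e / 2 by lra.
have [n nK] := cF _ _ cK (ball_cover_open dc e20).
exists n => f Ff x y Kx Ky.
by apply: (refines_ball_cover dc.1 nK Ff); apply: imageP.
Qed.

(** The estimate holds for all iterates of large order on one neighborhood of
[x]; this uniformity gives the continuity of the pseudometrics below. *)
Lemma locally_contracting_shrinks F d x e : locally_contracting F ->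
  continuous_pseudometrics R X d -> 0 < e ->
  exists N, \forall y \near x, forall f, fs_iter_ge F N f -> d (f x) (f y) < e.
Proof.
move=> [_ lF] dc e0; have e20 : 0 < e / 2 by lra.
have [W xW [n nW]] := lF _ _ (@compact_set1 _ x) (ball_cover_open dc e20).
have Wx : nbhs x W by exact: xW.
exists n; apply: filterS Wx => y Wy f Ff.
by apply: (refines_ball_cover dc.1 nW Ff); apply: imageP => //;
  exact: nbhs_singleton (xW _ _).
Qed.

Definition weight n : R := 2 - 2^-1 ^+ n.

(** The supremum is over all iterates of all orders. The factor [weight n] makes
the shift of orders by composition with a member of [F] a contraction, while its
values between 1 and 2 keep the result bounded and above [d]. *)
Definition orbit_sup F d x y : R :=
  sup [set z | exists n f, fs_iter F n f /\ z = weight n * d (f x) (f y)].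

Lemma weight_ge1 n : 1 <= weight n.
Proof.
rewrite /weight; have : (2^-1 : R) ^+ n <= 1 by apply: exprn_ile1; lra.
by lra.
Qed.

Lemma weight_le2 n : weight n <= 2.
Proof.
rewrite /weight; have : 0 <= (2^-1 : R) ^+ n by apply: exprn_ge0; lra.
by lra.
Qed.

(** [weight n.+1 - weight n] is [2^-n / 2], at least [2^-N / 2], whereas
[weight n.+1] is at most 2: this explains the 4. *)
Lemma weight_ratio n N : (n <= N)%N ->
  weight n <= (1 - 2^-1 ^+ N / 4) * weight n.+1.
Proof.
move=> nN; have := weight_le2 n.+1; rewrite /weight exprS.
have h : (2^-1 : R) ^+ N <= 2^-1 ^+ n.
  by apply: ler_wiXn2l => //; lra.
have h0 : 0 <= (2^-1 : R) ^+ N by apply: exprn_ge0; lra.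
by nra.
Qed.

Section Bounded.
Variables (F : set (X -> X)) (d : X -> X -> R).
Hypothesis dp : pseudometric d.
Hypothesis d1 : forall x y, d x y <= 1.

Lemma orbit_sup_ub n f x y : fs_iter F n f ->
  weight n * d (f x) (f y) <= orbit_sup F d x y.
Proof.
move=> Ff; apply: ub_le_sup; last by exists n, f.
exists 2 => _ [m [g [_ ->]]]; have [d0 _ _ _] := dp.
have := weight_le2 m; have := weight_ge1 m; have := d1 (g x) (g y).
by have := d0 (g x) (g y); nra.
Qed.

Lemma orbit_sup_le M x y :
  (forall n f, fs_iter F n f -> weight n * d (f x) (f y) <= M) ->
  orbit_sup F d x y <= M.
Proof.
move=> h; apply: ge_sup; first by exists (weight 0 * d x y), 0%N, idfun.
by move=> _ [n [f [Ff ->]]]; exact: h.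
Qed.

Lemma orbit_sup_ge x y : d x y <= orbit_sup F d x y.
Proof.
have := @orbit_sup_ub 0%N idfun x y erefl.
by rewrite /weight expr0 (_ : 2 - 1 = 1) ?mul1r//; lra.
Qed.

Lemma orbit_sup_pseudometric : pseudometric (orbit_sup F d).
Proof.
have [d0 dxx dC dT] := dp; split=> [x y|x|x y|x y z].
- exact: le_trans (d0 x y) (orbit_sup_ge x y).
- apply/eqP; rewrite eq_le; apply/andP; split.
    by apply: orbit_sup_le => n f _; rewrite dxx mulr0.
  exact: le_trans (d0 x x) (orbit_sup_ge x x).
- by apply/eqP; rewrite eq_le; apply/andP; split; apply: orbit_sup_le => n f Ff;
    rewrite dC; exact: orbit_sup_ub.
- apply: orbit_sup_le => n f Ff.
  apply: le_trans (lerD (orbit_sup_ub _ _ Ff) (orbit_sup_ub _ _ Ff)).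
  rewrite -mulrDr ler_wpM2l//; have := weight_ge1 n; lra.
Qed.

Lemma orbit_sup_le2 x y : orbit_sup F d x y <= 2.
Proof.
apply: orbit_sup_le => n f _; have [d0 _ _ _] := dp.
have := weight_le2 n; have := weight_ge1 n; have := d1 (f x) (f y).
by have := d0 (f x) (f y); nra.
Qed.

(** Let [s] be the left-hand supremum, assumed positive. Terms of order more
than [N] are at most [s / 2] and cannot determine it; the others are bounded
with the common ratio [lambda] of [weight_ratio]. *)
Lemma orbit_sup_edelstein g x y : F g ->
  (forall e, 0 < e -> exists N : nat, forall f, fs_iter_ge F N f ->
     d (f x) (f y) < e) ->
  exists2 lambda, lambda < 1 &
    orbit_sup F d (g x) (g y) <= lambda * orbit_sup F d x y.
Proof.
move=> Fg shr; set s := orbit_sup F d (g x) (g y).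
have [s0 _ _ _] := orbit_sup_pseudometric.
have [d0 _ _ _] := dp.
have [s_le0|s_gt0] := leP s 0.
  by exists 0; rewrite ?mul0r.
have e0 : 0 < s / 4 by lra.
have [N NF] := shr _ e0.
pose lambda : R := 1 - 2^-1 ^+ N / 4.
have l1 : lambda < 1.
  by rewrite /lambda; have : 0 < (2^-1 : R) ^+ N by apply: exprn_gt0; lra.
exists lambda => //.
have : s <= Num.max (lambda * orbit_sup F d x y) (s / 2).
  apply: orbit_sup_le => n h Fh; rewrite le_max.
  have Fhg : fs_iter F n.+1 (h \o g).
    by rewrite -addn1; exact: fs_iter_comp Fh (fs_iter1 Fg).
  have [nN|Nn] := leqP n N.
    apply/orP; left; have := orbit_sup_ub x y Fhg; have := weight_ratio nN.
    rewrite -/lambda /= => h1 h2.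
    apply: (@le_trans _ _ (lambda * (weight n.+1 * d (h (g x)) (h (g y))))).
      by rewrite mulrA ler_wpM2r.
    apply: ler_wpM2l => //; rewrite /lambda.
    have : (2^-1 : R) ^+ N <= 1 by apply: exprn_ile1; lra.
    by lra.
  apply/orP; right.
  have : d (h (g x)) (h (g y)) < s / 4.
    by apply: (NF (h \o g)); exists n.+1 => //=; apply: ltnW; apply: ltnW.
  have := weight_le2 n; have := weight_ge1 n; have := d0 (h (g x)) (h (g y)).
  by nra.
by rewrite le_max => /orP[//|]; lra.
Qed.

(** Orders at least [N] are controlled by hypothesis, and the finitely many
iterates of smaller order are controlled by their continuity. The filter [G] is
[nbhs x] for locally contracting systems, and its trace on a compact set for
systems on a [k]-space. *)
Lemma orbit_sup_near (G : set_system X) x : Filter G -> nbhs x `<=` G ->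
  function_system F -> continuous_pseudometrics R X d ->
  (forall e, 0 < e -> exists N, \forall y \near G,
     forall f, fs_iter_ge F N f -> d (f x) (f y) < e) ->
  forall e, 0 < e -> \forall y \near G, orbit_sup F d x y < e.
Proof.
move=> FG xG sF /continuous_pseudometrics_near[_ dn] shr e e0.
have e40 : 0 < e / 4 by lra.
have [d0 _ _ _] := dp.
have [N GN] := shr _ e40.
have GlN : \forall y \near G, forall n, `I_N n ->
    forall f, fs_iter F n f -> d (f x) (f y) < e / 4.
  apply: near_finite; first exact: finite_II.
  move=> n _; apply: near_finite; first by apply: fs_iter_finite; case: sF.
  move=> f Ff; apply: xG; have fc := fs_iter_continuous sF Ff.
  exact: (fc x _ (dn (f x) _ e40)).
near=> y; apply: (@le_lt_trans _ _ (e / 2)); last by lra.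
apply: orbit_sup_le => n f Ff.
have dlt : d (f x) (f y) < e / 4.
  have [nN|Nn] := ltnP n N.
    suff : forall n, `I_N n -> forall f, fs_iter F n f -> d (f x) (f y) < e / 4.
      by move=> /(_ n nN f Ff).
    by near: y.
  suff : forall f, fs_iter_ge F N f -> d (f x) (f y) < e / 4.
    by apply; exists n.
  by near: y.
have := weight_le2 n; have := weight_ge1 n; have := d0 (f x) (f y).
by nra.
Unshelve. all: by end_near. Qed.

End Bounded.

(** Truncation bounds the set of which [orbit_sup] is the supremum, without
changing small balls or Cauchy sequences. *)
Definition contracting_hull F d := orbit_sup F (truncate d).

Lemma contracting_hull_continuous_local F d : function_system F ->
  locally_contracting F -> continuous_pseudometrics R X d ->
  continuous_pseudometrics R X (contracting_hull F d).
Proof.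
move=> sF lF dc; apply/continuous_pseudometrics_near; split.
  apply: orbit_sup_pseudometric; first exact: truncate_pseudometric dc.1.
  exact: truncate_le1.
have tc := truncate_continuous dc.
move=> x; apply: (orbit_sup_near tc.1 _ _ sF tc) => //.
by move=> e e0; exact: locally_contracting_shrinks lF tc e0.
Qed.

(** In a [k]-space a ball is open once its trace on every compact set [K] is. On
[K] compact contraction makes the terms of large order uniformly small. *)
Lemma contracting_hull_continuous_k F d : k_space X -> function_system F ->
  compactly_contracting F -> continuous_pseudometrics R X d ->
  continuous_pseudometrics R X (contracting_hull F d).
Proof.
move=> kX sF cF dc.
have tc := truncate_continuous dc; have tp := tc.1.
have hp : pseudometric (contracting_hull F d).
  by apply: orbit_sup_pseudometric => //; exact: truncate_le1.
apply/continuous_pseudometrics_near; split => //.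
have [_ hxx _ hT] := hp.
move=> x e e0.
apply: open_nbhs_nbhs; split; last by rewrite /= hxx.
apply/kX => K cK; set U := [set y | contracting_hull F d x y < e].
have U_nbhs (y : X) : K y -> U y -> within K (nbhs y) (K `&` U).
  move=> Ky xy.
  have e'0 : 0 < e - contracting_hull F d x y by rewrite subr_gt0.
  have near_y : \forall z \near within K (nbhs y),
      contracting_hull F d y z < e - contracting_hull F d x y.
    apply: (orbit_sup_near tp _ _ sF tc _ e'0); first exact: cvg_within.
    move=> a a0; have [N NK] := compactly_contracting_shrinks cF tc cK a0.
    exists N; apply: filterS (withinT K (nbhs_filter y)) => z Kz f Ff.
    exact: NK.
  apply: filterS (filterI near_y (withinT K (nbhs_filter y))).
  by move=> z [/= yz Kz]; split => //=; have := hT x y z; rewrite /U /=; lra.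
rewrite openE => y [Ky Uy].
by have := U_nbhs y Ky Uy; rewrite (@nbhs_subspace_in X K y Ky).
Qed.

Lemma contracting_hull_le2 F d x y : pseudometric d ->
  contracting_hull F d x y <= 2.
Proof.
by move=> dp; apply: orbit_sup_le2; [exact: truncate_pseudometric|
  exact: truncate_le1].
Qed.

Lemma truncate_le_contracting_hull F d x y : pseudometric d ->
  truncate d x y <= contracting_hull F d x y.
Proof.
by move=> dp; apply: orbit_sup_ge; [exact: truncate_pseudometric|
  exact: truncate_le1].
Qed.

Lemma contracting_hull_edelstein F (D : set (X -> X -> R)) :
  compactly_contracting F -> D `<=` continuous_pseudometrics R X ->
  edelstein_contracting F (contracting_hull F @` D).
Proof.
move=> cF Dc _ f [d Dd <-] Ff x y.
have tc := truncate_continuous (Dc d Dd).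
apply: orbit_sup_edelstein => //; [exact: tc.1|exact: truncate_le1|].
move=> e e0; have cxy : compact [set x; y].
  by apply: compactU; exact: compact_set1.
have [N NK] := compactly_contracting_shrinks cF tc cxy e0.
by exists N => g Fg; apply: NK => //; [left|right].
Qed.

Lemma contracting_hull_admissible F (D : set (X -> X -> R)) : admissible D ->
  contracting_hull F @` D `<=` continuous_pseudometrics R X ->
  admissible (contracting_hull F @` D).
Proof.
move=> aD hc; apply: admissible_dominating (aD) (hc) _ => d Dd.
exists (contracting_hull F d); first by exists d.
by move=> x y; apply: truncate_le_contracting_hull; apply: aD.1.1.
Qed.

Lemma contracting_hull_bounded F (D : set (X -> X -> R)) : multimetric D ->
  bounded_multimetric (contracting_hull F @` D).
Proof.
move=> [Dp _] _ [d Dd <-]; exists 2 => x y.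
by apply: contracting_hull_le2; exact: Dp.
Qed.

(** A sequence that is Cauchy for the hull of [d] is Cauchy for the truncation
of [d], hence for [d]. *)
Lemma contracting_hull_seq_complete F :
  seq_complete_space R X ->
  seq_complete (contracting_hull F @` continuous_pseudometrics R X).
Proof.
move=> scX u hu; apply: scX => d dc e e0.
have m0 : 0 < Num.min e 1 by rewrite lt_min e0 ltr01.
have [|N NP] := hu (contracting_hull F d) _ _ m0; first by exists d.
exists N => m n Nm Nn.
have := le_lt_trans (truncate_le_contracting_hull F (u m) (u n) dc.1)
  (NP m n Nm Nn).
rewrite /truncate lt_min => /andP[+ h]; move: h.
by rewrite gt_min ltxx orbF => h1; rewrite (min_idPl (ltW h1)).
Qed.

End OrbitSup.

(** * Sets of least cardinality *)

Section MinimalCardinality.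
Local Open Scope card_scope.

(** Let [S] be a maximal set of choice functions [s] for [A] such that each
evaluation [s |-> s B] with [B] in [A] is injective on [S]. If no evaluation
covered its target, a choice function taking a new value in every [B] could be
added to [S]. So some [C] in [A] is covered by an image of [S], while [S]
embeds into every [B]. *)
Lemma minimal_cardinal (T : pointedType) (A : set (set T)) : A !=set0 ->
  exists2 C, A C & forall B, A B -> C #<= B.
Proof.
move=> [C0 AC0].
pose P (S : set (set T -> T)) := forall B, A B ->
  set_fun S B (fun s => s B) /\ set_inj S (fun s => s B).
have [S [PS Smax]] : exists S, P S /\ forall S', S `<` S' -> ~ P S'.
  apply: Zorn_bigcup => FS FP tot B AB; split.
    by move=> s [S FSS Ss]; exact: ((FP _ FSS B AB).1 s Ss).
  move=> s t; rewrite !inE => -[S FSS Ss] [S' FSS' St] E.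
  have [SS'|S'S] := tot _ _ FSS FSS'.
    by apply: (FP _ FSS' B AB).2; rewrite ?inE//; exact: SS'.
  by apply: (FP _ FSS B AB).2; rewrite ?inE//; exact: S'S.
have [C AC SC] : exists2 C, A C & C `<=` [set s C | s in S].
  apply: contrapT => nC.
  have [s0 s0P] : {s0 : set T -> T & forall C, A C ->
      C (s0 C) /\ ~ [set s C | s in S] (s0 C)}.
    apply: (@choice _ _ (fun C c => A C -> C c /\ ~ [set s C | s in S] c)) => C.
    have [AC|nAC] := pselect (A C); last by exists point.
    apply: contrapT => nc; apply: nC; exists C => // c Cc.
    by apply: contrapT => nSc; apply: nc; exists c.
  apply: (Smax (S `|` [set s0])).
    split; first by move=> s; left.
    move=> h; have [_] := s0P _ AC0; apply.
    by exists s0 => //; apply: h; right.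
  move=> B AB; have [Sfun Sinj] := PS B AB; have [Bs0 ns0] := s0P B AB.
  split; first by move=> s [/Sfun//|->].
  move=> s t; rewrite !inE => -[Ss|->] [St|->] // E.
  - by apply: Sinj => //; rewrite inE.
  - by exfalso; apply: ns0; exists s.
  - by exfalso; apply: ns0; exists t.
exists C => // B AB.
apply: (@card_le_trans _ _ _ S).
  by apply: card_le_trans (subset_card_le SC) (card_image_le _ _).
have /injfunPex[f] : exists2 f : (set T -> T) -> T, set_fun S B f & set_inj S f.
  by have [Sf Si] := PS B AB; exists (fun s => s B).
exact: inj_card_le.
Qed.

End MinimalCardinality.

(** * Contracting systems from contracting pseudometrics *)

Section EdelsteinLocal.
Context {R : realType} {X : topologicalType}.
Implicit Types (F : set (X -> X)) (d : X -> X -> R) (K : set X).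
Implicit Types (D : set (X -> X -> R)).

Lemma compact_bounded d K : continuous_pseudometrics R X d -> compact K ->
  exists M, forall x y, K x -> K y -> d x y <= M.
Proof.
move=> /continuous_pseudometrics_near[[d0 dxx dC dT] dn] cK.
have [[x0 Kx0]|K0] := pselect (K !=set0); last first.
  by exists 0 => x y Kx; exfalso; apply: K0; exists x.
have : \forall n \near \oo, K `<=` (fun y => d x0 y <= n%:R).
  apply: ((@compact_near_coveringP X K).1 cK nat \oo
    (fun n y => d x0 y <= n%:R)) => y Ky.
  exists ([set y' | d y y' < 1], [set n | d x0 y + 1 <= n%:R]).
    by split => /=; [exact: dn|exact: nbhs_infty_ger].
  by move=> [y' n] /= [yy' hn]; have := dT x0 y y'; lra.
move=> [n _ /(_ n (leqnn n)) hn]; exists (n%:R + n%:R) => x y /hn xn /hn yn.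
by have := dT x x0 y; rewrite (dC x x0); lra.
Qed.

Section OneMetric.
Variables (F : set (X -> X)) (d : X -> X -> R).
Hypothesis F_system : function_system F.
Hypothesis dc : continuous_pseudometrics R X d.
Hypothesis F_edelstein : edelstein_contracting F [set d].

Lemma edelstein_le f x y : F f -> d (f x) (f y) <= d x y.
Proof.
move=> Ff; have [[d0 _ _ _] _] := dc.
have [l l1] := F_edelstein erefl Ff x y.
by have := d0 x y; nra.
Qed.

Lemma edelstein_lt f x y : F f -> 0 < d x y -> d (f x) (f y) < d x y.
Proof.
move=> Ff dxy; have [l l1] := F_edelstein erefl Ff x y.
by nra.
Qed.

Lemma edelstein_iter_le n f x y : fs_iter F n f -> d (f x) (f y) <= d x y.
Proof.
elim: n f => [_ ->//|n IH _ [f Ff [g Fg <-]]] /=.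
exact: le_trans (edelstein_le _ _ Ff) (IH _ Fg).
Qed.

(** Near a pair [(x, y)] of [K] at distance at least [e], the loss stays above
some [1 / (n + 1)] because [d] is continuous and the maps in [F] are
non-expansive; compactness of [K `*` K] makes [n] uniform. *)
Lemma edelstein_gap K e : compact K -> 0 < e ->
  exists2 eta, 0 < eta & forall f, F f -> forall x y, K x -> K y ->
    e <= d x y -> d (f x) (f y) <= d x y - eta.
Proof.
move=> cK e0; have [_ finF Fc] := F_system.
have /continuous_pseudometrics_near[[_ _ dC dT] dn] := dc.
have cKK : compact (K `*` K) by exact: compact_setX.
pose P f n (p : X * X) := e <= d p.1 p.2 ->
  d (f p.1) (f p.2) <= d p.1 p.2 - n.+1%:R^-1.
have ev : \forall n \near \oo, forall f, F f -> K `*` K `<=` P f n.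
  apply: near_finite => // f Ff.
  apply: ((@compact_near_coveringP _ (K `*` K)).1 cKK nat \oo (P f)).
  move=> [x y] [Kx Ky].
  have near_xy eta : 0 < eta ->
      nbhs (x, y) [set p : X * X | d x p.1 < eta /\ d y p.2 < eta].
    move=> eta0; exists ([set x' | d x x' < eta], [set y' | d y y' < eta]).
      by split; exact: dn.
    by move=> [x' y'].
  have [exy|xye] := leP e (d x y); last first.
    pose eta := (e - d x y) / 2; have eta0 : 0 < eta by rewrite /eta; lra.
    exists ([set p | d x p.1 < eta /\ d y p.2 < eta], setT) => /=.
      by split; [exact: near_xy|exact: filterT].
    move=> [[x' y'] n] /= [[xx' yy'] _]; rewrite /P /= => ex'y'.
    have := dT x' x y'; have := dT x y y'; rewrite (dC x' x).
    by move: xx' yy'; rewrite /eta; lra.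
  have lt := edelstein_lt Ff (lt_le_trans e0 exy).
  (* moving both points by [eta] changes each of the two distances by at most
     [2 * eta], and the loss itself takes one more [eta] *)
  pose eta := (d x y - d (f x) (f y)) / 5.
  have eta0 : 0 < eta by rewrite /eta; lra.
  exists ([set p | d x p.1 < eta /\ d y p.2 < eta],
          [set n : nat | n.+1%:R^-1 < eta]) => /=.
    by split; [exact: near_xy|exact: (near_infty_natSinv_lt (PosNum eta0))].
  move=> [[x' y'] n] /= [[xx' yy'] n_eta] _ /=.
  have := dT (f x') (f x) (f y'); have := dT (f x) (f y) (f y').
  have := edelstein_le x x' Ff; have := edelstein_le y y' Ff.
  have := dT x x' y; have := dT x' y' y; rewrite (dC y' y) (dC (f x') (f x)).
  move: xx' yy' n_eta; rewrite /eta; move: (n.+1%:R^-1) => a; lra.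
have [n _ /(_ n (leqnn n)) hn] := ev.
exists n.+1%:R^-1; first by rewrite invr_gt0.
by move=> f Ff x y Kx Ky; exact: (hn f Ff (x, y) (conj Kx Ky)).
Qed.

(** As long as a pair of [K] stays at distance at least [e], each map brings its
points closer by [eta]; starting from a distance at most [M], this can happen at
most [M / eta] times. Once below [e], distances stay there. *)
Lemma edelstein_shrinks K e : compact K -> fs_image F K `<=` K -> 0 < e ->
  exists N : nat, forall f, fs_iter_ge F N f ->
    forall x y, K x -> K y -> d (f x) (f y) < e.
Proof.
move=> cK FK e0; have [eta eta0 gap] := edelstein_gap cK e0.
have [M bM] := compact_bounded dc cK.
have [d0 _ _ _] := dc.1.
have iter n f x y : fs_iter F n f -> K x -> K y ->
    d (f x) (f y) < e \/ d (f x) (f y) <= M - n%:R * eta.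
  move=> + Kx Ky; elim: n f => [_ ->|n IH _ [f Ff [g Fg <-]]] /=.
    by right; rewrite mul0r subr0; exact: bM.
  have [ge|eg] := ltP (d (g x) (g y)) e.
    by left; exact: le_lt_trans (edelstein_le _ _ Ff) ge.
  right; have [|gn] := IH g Fg; first by rewrite ltNge eg.
  have Kg z : K z -> K (g z).
    by move=> Kz; apply: fs_iter_invariant FK Fg _ _; exists z.
  have := gap f Ff _ _ (Kg _ Kx) (Kg _ Ky) eg.
  by rewrite -addn1 natrD mulrDl mul1r; lra.
have [N _ hN] : \forall n \near \oo, M / eta < n%:R by exact: nbhs_infty_gtr.
exists N => f [n Nn Ff] x y Kx Ky.
have [//|h] := iter n f x y Ff Kx Ky.
have := hN n Nn; rewrite /= ltr_pdivrMr// => h'.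
by have := d0 (f x) (f y); lra.
Qed.

End OneMetric.

Lemma pm_sum_edelstein F D s : admissible D -> edelstein_contracting F D ->
  family_in D s -> edelstein_contracting F [set pm_sum s].
Proof.
move=> [[Dp _] _] eF Ds _ f -> Ff x y.
pose P d := pseudometric d /\
  exists2 l : R, l < 1 & d (f x) (f y) <= l * d x y.
suff [//] : P (pm_sum s).
apply: pm_sum_ind Ds.
- split; first exact: pseudometric0.
  by exists 0; rewrite ?mul0r.
- move=> d d' _ [dp [l l1 h]] [dp' [l' l1' h']].
  split; first exact: pseudometricD.
  exists (Num.max l l'); first by rewrite gt_max l1.
  have [d0 _ _ _] := dp; have [d0' _ _ _] := dp'.
  rewrite mulrDr; apply: lerD.
    by apply: le_trans h _; rewrite ler_wpM2r// le_max lexx.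
  by apply: le_trans h' _; rewrite ler_wpM2r// le_max lexx orbT.
- by move=> d Dd; split; [exact: Dp|exact: (eF d f Dd Ff x y)].
Qed.

Lemma pm_sum_continuous D s : admissible D -> family_in D s ->
  continuous_pseudometrics R X (pm_sum s).
Proof.
move=> aD Ds; apply/continuous_pseudometrics_near; split.
  by apply: pm_sum_pseudometric Ds; case: aD => -[].
by move=> x e e0; exact: admissible_pm_sum_near Ds e0.
Qed.

(** Local radii come with different finite sums of pseudometrics. Radii and sums
are refined simultaneously along the filter [G], which is directed by
concatenating the lists and taking the minimum of the radii. *)
Lemma lebesgue_number D K UU : admissible D -> compact K -> open_cover UU ->
  exists s e, [/\ family_in D s, 0 < e & forall x, K x ->
    exists2 V, UU V & forall y, pm_sum s x y < e -> V y].
Proof.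
move=> aD cK [oUU cUU].
have [[Dp _] _] := aD.
pose I := (seq (X -> X -> R) * R)%type.
pose fine (i : I) : set I := [set j | [/\ family_in D j.1,
  0 < j.2 <= i.2 & forall x y, pm_sum i.1 x y <= pm_sum j.1 x y]].
pose G := filter_from [set i : I | family_in D i.1 /\ 0 < i.2] fine.
have FG : Filter G.
  apply: filter_from_filter; first by exists ([::], 1); split => /=.
  move=> [s e] [s' e'] /= [Ds e0] [Ds' e0'].
  have [h _ _ _] := pm_sum_pseudometric Dp Ds.
  have [h' _ _ _] := pm_sum_pseudometric Dp Ds'.
  exists (s ++ s', Num.min e e').
    by split; [exact: (family_in_cat Ds Ds')|rewrite /= lt_min e0].
  move=> [t a] [/= Dt /andP[a0]]; rewrite le_min => /andP[ae ae'] st.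
  split; split => //=; rewrite ?a0 // => x y; have := st x y;
    rewrite pm_sum_cat; have := h x y; have := h' x y; lra.
pose P (i : I) x := exists2 V, UU V & forall y, pm_sum i.1 x y < i.2 -> V y.
have : \forall i \near G, K `<=` P i.
  apply: ((@compact_near_coveringP X K).1 cK I G P FG) => x Kx.
  have [V UV Vx] : exists2 V, UU V & V x.
    by have : [set: X] x by []; rewrite -cUU => -[V UV Vx]; exists V.
  have [s [e [Ds e0 sV]]] := admissible_ball aD (oUU V UV) Vx.
  have e20 : 0 < e / 2 by lra.
  exists ([set x' | pm_sum s x x' < e / 2], fine (s, e / 2)) => /=.
    split; first exact: admissible_pm_sum_near Ds e20.
    by exists (s, e / 2).
  move=> [x' [t a]] /= [xx' [/= Dt /andP[a0 ae] st]].
  exists V => // y /= x'y; apply: sV.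
  have [_ _ _ hT] := pm_sum_pseudometric Dp Ds.
  by have := hT x x' y; have := st x' y; lra.
move=> [[s e] [/= Ds e0] h]; exists s, e; split => //.
by apply: (h (s, e)); split => //=; rewrite e0 lexx.
Qed.

(** Iterates of order at least [N] shrink [K] to diameter less than [e / 2], and
they do not expand the [e / 4]-neighborhood of [K]; hence they map it into a
ball of radius [e] around a point of [K]. *)
Lemma edelstein_locally_contracting F D : [set: X] !=set0 ->
  function_system F -> compact_dominating F -> admissible D ->
  edelstein_contracting F D -> locally_contracting F.
Proof.
move=> X0 sF dF aD eF; split; first exact: has_invariant_compact_dominating.
move=> K0 UU cK0 oUU; have [x0 _] := X0.
have [K [cK K0K FK]] := dF _ (compactU cK0 (@compact_set1 _ x0)).
have [s [e [Ds e0 Kball]]] := lebesgue_number aD cK oUU.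
have dc := pm_sum_continuous aD Ds.
have de := pm_sum_edelstein aD eF Ds.
have e20 : 0 < e / 2 by lra.
have e40 : 0 < e / 4 by lra.
have [N NK] := edelstein_shrinks sF dc de cK FK e20.
exists [set z | exists2 x, K x & pm_sum s x z < e / 4].
  move=> x Kx; have /continuous_pseudometrics_near[_ /(_ x _ e40)] := dc.
  by apply: filterS => z xz; exists x => //; apply: K0K; left.
exists N => _ [f Ff <-].
have Kx0 : K x0 by apply: K0K; right.
have [n _ Fn] := Ff.
have Kf : K (f x0) by apply: fs_iter_invariant FK Fn _ _; exists x0.
have [V UV fV] := Kball _ Kf; exists V => // _ [z [x Kx xz] <-]; apply: fV.
have [_ _ _ dT] := dc.1.
have := dT (f x0) (f x) (f z); have := NK f Ff _ _ Kx0 Kx.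
by have := edelstein_iter_le dc de x z Fn; lra.
Qed.

(** Taking hulls does not increase the cardinality, so the hulls of an
admissible multimetric of least cardinality form another one. *)
Lemma contracting_hull_edelstein_bounded_mn F :
  tychonoff_space X -> compactly_contracting F ->
  (forall d, continuous_pseudometrics R X d ->
     continuous_pseudometrics R X (contracting_hull F d)) ->
  exists D, [/\ admissible D, bounded_multimetric D, card_eq_mn R X D
    & edelstein_contracting F D].
Proof.
move=> tX cF hc.
have [D0 aD0 minD0] : exists2 D0 : set (X -> X -> R), admissible D0 &
    forall D, admissible D -> (D0 #<= D)%card.
  apply: (@minimal_cardinal (X -> X -> R)).
  by eexists; exact: continuous_pseudometrics_admissible tX.
have D0c : D0 `<=` continuous_pseudometrics R X.
  by move=> d Dd; have [[Dp _] [Dc _]] := aD0; split; [exact: Dp|exact: Dc].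
have aD : admissible (contracting_hull F @` D0).
  by apply: contracting_hull_admissible => // _ [d /D0c dc <-]; exact: hc.
exists (contracting_hull F @` D0); split => //.
- exact: contracting_hull_bounded aD0.1.
- split; first by exists (contracting_hull F @` D0) => //; exact: card_eqxx.
  by move=> D /minD0; apply: card_le_trans; exact: card_image_le.
- exact: contracting_hull_edelstein.
Qed.

End EdelsteinLocal.

End EdelsteinMetrization.

Theorem theorem6p3 (R : realType) (X : topologicalType) (F : set (X -> X))
    (X_nonempty : [set: X] !=set0) (X_tychonoff : tychonoff_space X)
    (F_system : function_system F) (F_dominating : compact_dominating F) :
  let edelstein_some := exists D : set (X -> X -> R),
    admissible D /\ edelstein_contracting F D in
  let edelstein_bounded_mn := exists D : set (X -> X -> R),
    [/\ admissible D, bounded_multimetric D, card_eq_mn R X D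
      & edelstein_contracting F D] in
  let edelstein_seq_complete := exists D : set (X -> X -> R),
    [/\ seq_complete D, admissible D, bounded_multimetric D
      & edelstein_contracting F D] in
  [/\ [<-> locally_contracting F; edelstein_some; edelstein_bounded_mn],
      k_space X ->
        [<-> locally_contracting F; edelstein_some; edelstein_bounded_mn;
             topologically_contracting F; compactly_contracting F]
    & seq_complete_space R X ->
        [<-> locally_contracting F; edelstein_some; edelstein_bounded_mn;
             edelstein_seq_complete]].
Proof.
move=> edelstein_some edelstein_bounded_mn edelstein_seq_complete.
have [X_hausdorff _] := X_tychonoff.
have some_local : edelstein_some -> locally_contracting F.
  move=> [D [D_admissible F_edelstein]].
  exact: edelstein_locally_contracting F_edelstein.
have mn_some : edelstein_bounded_mn -> edelstein_some.
  by move=> [D [? _ _ ?]]; exists D.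
have local_compact := @locally_compactly_contracting X F.
have local_mn : locally_contracting F -> edelstein_bounded_mn.
  move=> F_local; apply: contracting_hull_edelstein_bounded_mn => //.
    exact: local_compact.
  by move=> d; exact: contracting_hull_continuous_local.
split; [|move=> X_k|move=> X_complete].
- by tfae => [/local_mn/mn_some|/some_local/local_mn|/mn_some/some_local].
- tfae => [/local_mn/mn_some//|/some_local/local_mn//|||].
  + move=> /mn_some/some_local/local_compact.
    exact: compactly_topologically_contracting.
  + exact: topologically_compactly_contracting.
  + move=> F_compact; apply/some_local/mn_some.
    apply: contracting_hull_edelstein_bounded_mn => // d.
    exact: contracting_hull_continuous_k.
- tfae => [/local_mn/mn_some//|/some_local/local_mn//||].
  + move=> /mn_some/some_local F_local.
    have DX_admissible := @continuous_pseudometrics_admissible R X X_tychonoff.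
    exists (contracting_hull F @` continuous_pseudometrics R X); split.
    * exact: contracting_hull_seq_complete.
    * apply: contracting_hull_admissible => // _ [d d_cont <-].
      exact: contracting_hull_continuous_local.
    * exact: contracting_hull_bounded DX_admissible.1.
    * by apply: contracting_hull_edelstein => //; exact: local_compact.
  + by move=> [D [_ ? _ ?]]; apply: some_local; exists D.
Qed.
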